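(* Let $(a_i)_{i\ge1}$ be a non-decreasing sequence of positive numbers. Then almost surely the event $\{S(n)>0\}$ holds for infinitely many $n$, and likewise almost surely the event $\{S(n)<0\}$ holds for infinitely many $n$.
   Context: Let $X_1,X_2,\dots$ be i.i.d. with $P(X_i=1)=P(X_i=-1)=\frac12$, and $S(n)=\sum_{k=1}^n a_kX_k$, $S(0)=0$. *)

(* Defs.v *)
From HB Require Import structures.
From mathcomp Require Export all_boot all_order all_algebra finmap.
From mathcomp Require Export all_classical all_reals all_analysis.

Set Implicit Arguments.
Unset Strict Implicit.
Unset Printing Implicit Defensive.

Import Order.TTheory GRing.Theory Num.Theory.
Import numFieldNormedType.Exports.

Local Open Scope classical_set_scope.
Local Open Scope ring_scope.

Definition mutually_independent (d d' : measure_display)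
    (T : measurableType d) (T' : measurableType d') (R : realType)
    (P : probability T R) (I : choiceType) (X : I -> {RV P >-> T'}) : Prop :=
  forall (J : {fset I}) (B : I -> set T'),
    (forall i, i \in J -> measurable (B i)) ->
    P (\bigcap_(i in [set` J]) (X i @^-1` B i)) =
      (\prod_(i <- J) P (X i @^-1` B i))%E.

Definition rademacher (d : measure_display) (T : measurableType d)
    (R : realType) (P : probability T R) (X : {RV P >-> R}) : Prop :=
  P (X @^-1` [set 1]) = (2^-1)%:E /\ P (X @^-1` [set -1]) = (2^-1)%:E.

(* The law is fixed by [rademacher], so identical distribution is implied. *)
Definition iid_rademacher (d : measure_display) (T : measurableType d)
    (R : realType) (P : probability T R) (X : nat -> {RV P >-> R}) : Prop :=
  mutually_independent X /\ forall i, rademacher (X i).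

(* Sequences are indexed from 0: [a k] and [X k] stand for the mathematical
   a_{k+1} and X_{k+1}, so that S(n) sums the first n terms and S(0) = 0. *)
Definition weighted_sum (d : measure_display) (T : measurableType d)
    (R : realType) (P : probability T R) (a : nat -> R)
    (X : nat -> {RV P >-> R}) (n : nat) (w : T) : R :=
  \sum_(k < n) a k * X k w.

(* Main.v *)
Require Import Defs.
From mathcomp Require Import lra.
Set Implicit Arguments.
Unset Strict Implicit.
Unset Printing Implicit Defensive.
Import Order.TTheory GRing.Theory Num.Theory.
Import numFieldNormedType.Exports.
Local Open Scope classical_set_scope.
Local Open Scope ring_scope.

(** As the weights are positive and non-decreasing, every step of the walk has
size at least [delta = a 0 > 0]; this uniform bound drives the argument.

For a region [D] of the line, let [v i x] be the probability that the walk
which is at [x] at time [i] stays in [D] forever.  Two facts about [v] carry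
the proof.
- Zero-one law ([survival_zero_one]): if [v <= t < 1] uniformly, then [v = 0].
  Surviving forever means surviving [m] steps and then forever, so
  [v <= t * (probability of surviving m steps)], and letting [m] grow gives
  [v <= t * v].
- Reflection ([survival_nonpos]): for the half-line [y <= 0] and a start [x],
  the event of never exceeding [0] and its mirror image around [x], never
  falling below [2 x], are equally likely, and together they confine the walk
  to a bounded strip.  A bounded strip is left almost surely, since enough
  consecutive up-steps, each of size at least [delta], lead out of it
  ([survival_bounded]).  Hence [2 v <= 1 + 0], and the zero-one law turns
  [v <= 1/2] into [v = 0].

These probabilities are defined by a numerical recursion on the remaining
number of steps, so that both facts are elementary statements about reals.
By independence, each prescribed sign word of length [n] has probability
[2^-n] ([prob_cylinder]); conditioning on the word read so far then bounds the
true probability by the recursion ([stay_cover]).  If [S n > 0] holds for only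
finitely many [n], then the walk is confined to [y <= 0] after some finite
sign word, and there are countably many words, each contributing a null event
([escape_infinitely_often]).  The claim on [S n < 0] is the same one for the
half-line [0 <= y]. *)

(** * Survival probabilities of the weighted walk *)

(** Probability that a walk at [x] at time [i], whose step at time [k] is
[+ a k] or [- a k] with equal chances, is in [D] at the times
[i, ..., i + m]. *)
Fixpoint stay (R : realType) (a : nat -> R) (D : pred R) (i m : nat) (x : R) : R :=
  if D x then
    if m is m'.+1
    then (stay a D i.+1 m' (x + a i) + stay a D i.+1 m' (x - a i)) / 2
    else 1
  else 0.

Definition survival (R : realType) (a : nat -> R) (D : pred R) (i : nat) (x : R) : R :=
  limn (fun m => stay a D i m x).

Lemma stay_out (R : realType) (a : nat -> R) (D : pred R) i m x :
  ~~ D x -> stay a D i m x = 0.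
Proof. by case: m => [|m] /= /negbTE ->. Qed.

Lemma stayS (R : realType) (a : nat -> R) (D : pred R) i m x : D x ->
  stay a D i m.+1 x =
  (stay a D i.+1 m (x + a i) + stay a D i.+1 m (x - a i)) / 2.
Proof. by move=> /= ->. Qed.

Lemma stay_ge0 (R : realType) (a : nat -> R) (D : pred R) i m x :
  0 <= stay a D i m x.
Proof.
elim: m i x => [|m IH] i x /=; case: ifP => // _.
have := IH i.+1 (x + a i); have := IH i.+1 (x - a i); lra.
Qed.

Lemma stay_le1 (R : realType) (a : nat -> R) (D : pred R) i m x :
  stay a D i m x <= 1.
Proof.
elim: m i x => [|m IH] i x /=; case: ifP => // _.
have := IH i.+1 (x + a i); have := IH i.+1 (x - a i); lra.
Qed.

Lemma stay_nonincreasing (R : realType) (a : nat -> R) (D : pred R) i x :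
  nonincreasing_seq (fun m => stay a D i m x).
Proof.
apply/nonincreasing_seqP => m; elim: m i x => [|m IH] i x.
  have [Dx|nDx] := boolP (D x); last by rewrite !stay_out.
  by rewrite [leRHS]/= Dx stay_le1.
have [Dx|nDx] := boolP (D x); last by rewrite !stay_out.
rewrite !(@stayS _ _ _ _ _ x) //.
have := IH i.+1 (x + a i); have := IH i.+1 (x - a i); lra.
Qed.

Lemma stay_cvg (R : realType) (a : nat -> R) (D : pred R) i x :
  (fun m => stay a D i m x) @ \oo --> survival a D i x.
Proof.
apply: (@nonincreasing_is_cvgn _ (fun m => stay a D i m x)).
  exact: stay_nonincreasing.
by exists 0 => _ [m _ <-]; apply: stay_ge0.
Qed.

Lemma survival_le_stay (R : realType) (a : nat -> R) (D : pred R) i m x :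
  survival a D i x <= stay a D i m x.
Proof.
apply: (@nonincreasing_cvgn_ge _ (fun m => stay a D i m x)).
  exact: stay_nonincreasing.
exact: stay_cvg.
Qed.

Lemma survival_ge0 (R : realType) (a : nat -> R) (D : pred R) i x :
  0 <= survival a D i x.
Proof.
apply: limr_ge; first exact: stay_cvg.
by apply: nearW => m; apply: stay_ge0.
Qed.

Lemma survival_out (R : realType) (a : nat -> R) (D : pred R) i x :
  ~~ D x -> survival a D i x = 0.
Proof.
move=> nDx; apply/eqP; rewrite eq_le survival_ge0 andbT.
by rewrite -(stay_out a i 0 nDx) survival_le_stay.
Qed.

Lemma survival_step (R : realType) (a : nat -> R) (D : pred R) i x : D x ->
  survival a D i x =
  (survival a D i.+1 (x + a i) + survival a D i.+1 (x - a i)) / 2.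
Proof.
move=> Dx; rewrite {1}/survival; apply: cvg_lim => //.
rewrite -(cvg_shiftS (fun m => stay a D i m x)).
under eq_fun do rewrite stayS //.
by apply: cvgMr_tmp; apply: cvgD; apply: stay_cvg.
Qed.

(** The Markov property: the bound [t] applies to the position reached after [m]
steps, whatever it is. *)
Lemma survival_le_mul_stay (R : realType) (a : nat -> R) (D : pred R) (t : R) :
  (forall i x, survival a D i x <= t) ->
  forall m i x, survival a D i x <= t * stay a D i m x.
Proof.
move=> ht; elim=> [|m IH] i x; have [Dx|nDx] := boolP (D x);
  rewrite ?(survival_out _ _ nDx) ?(stay_out _ _ _ nDx) ?mulr0 //.
  by rewrite /= Dx mulr1.
rewrite survival_step // stayS //.
have := IH i.+1 (x + a i); have := IH i.+1 (x - a i); lra.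
Qed.

(** A uniform bound below [1] contracts to [0], because it can be applied again
after an arbitrarily long time of survival. *)
Lemma survival_zero_one (R : realType) (a : nat -> R) (D : pred R) (t : R) :
  t < 1 -> (forall i x, survival a D i x <= t) ->
  forall i x, survival a D i x = 0.
Proof.
move=> t1 ht i x.
have v0 := survival_ge0 a D i x.
have : survival a D i x <= t * survival a D i x.
  apply: (@ler_cvg_to _ \oo _ _ (cst (survival a D i x)) (fun m => t * stay a D i m x)).
  - exact: cvg_cst.
  - by apply: cvgMl_tmp; apply: stay_cvg.
  - by apply: nearW => m; apply: survival_le_mul_stay.
nra.
Qed.

(** * Escape from strips and half-lines *)

(** The run of [m] consecutive up-steps has probability [2^-m] and ends above
[c], hence outside [D]. *)
Lemma stay_above_le (R : realType) (a : nat -> R) (D : pred R) (delta c : R) :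
  (forall k, delta <= a k) -> (forall y, D y -> y <= c) ->
  forall m i x, c < x + m%:R * delta -> stay a D i m x <= 1 - 2^-1 ^+ m.
Proof.
move=> ha hD; elim=> [|m IH] i x.
  rewrite mul0r addr0 expr0 subrr => cx.
  by rewrite stay_out //; apply/negP => /hD; rewrite leNgt cx.
move=> cx; have [Dx|nDx] := boolP (D x); last first.
  by rewrite stay_out // subr_ge0 exprn_ile1 //; lra.
rewrite stayS // exprS.
have up : stay a D i.+1 m (x + a i) <= 1 - 2^-1 ^+ m.
  apply: IH; apply: lt_le_trans cx _.
  by rewrite -natr1 mulrDl mul1r; have := ha i; lra.
have := stay_le1 a D i.+1 m (x - a i); lra.
Qed.

(** From any point of the strip [b, c], a fixed number [K] of up-steps leads out,
so the survival probability is uniformly at most [1 - 2^-K]. *)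
Lemma survival_bounded (R : realType) (a : nat -> R) (D : pred R)
    (delta b c : R) :
  0 < delta -> (forall k, delta <= a k) -> (forall y, D y -> b <= y <= c) ->
  forall i x, survival a D i x = 0.
Proof.
move=> d0 ha hD.
have [K hK] : exists K : nat, (c - b) / delta < K%:R.
  exists (Num.bound `|(c - b) / delta|).
  exact: le_lt_trans (ler_norm _) (archi_boundP (normr_ge0 _)).
apply: (@survival_zero_one _ _ _ (1 - 2^-1 ^+ K)).
  by rewrite ltrBlDr ltrDl exprn_gt0 // invr_gt0.
move=> i x; apply: le_trans (survival_le_stay a D i K x) _.
have [Dx|nDx] := boolP (D x); last first.
  by rewrite stay_out // subr_ge0 exprn_ile1 //; lra.
apply: (@stay_above_le _ _ _ delta c) => // [y /hD/andP[]//|].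
by move: hK; rewrite ltr_pdivrMr //; have /andP[] := hD _ Dx; lra.
Qed.

(** The steps are symmetric, so their law is invariant under [y |-> c - y]. *)
Lemma stay_reflect (R : realType) (a : nat -> R) (D : pred R) (c : R) m i x :
  stay a (fun y => D (c - y)) i m x = stay a D i m (c - x).
Proof.
elim: m i x => [//|m IH] i x /=; case: ifP => // _.
by rewrite !IH addrC !opprD opprK !addrA.
Qed.

(** Inclusion-exclusion for the events of staying in [D] and of staying in [D'],
whose intersection is the event of staying in both. *)
Lemma stay_add_le (R : realType) (a : nat -> R) (D D' : pred R) m i x :
  stay a D i m x + stay a D' i m x <= 1 + stay a (predI D D') i m x.
Proof.
elim: m i x => [|m IH] i x /=; case: (D x); case: (D' x) => //=;
  rewrite ?(addr0, add0r) ?ler01 //.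
- have := IH i.+1 (x + a i); have := IH i.+1 (x - a i); lra.
- have := stay_le1 a D i.+1 m (x + a i).
  have := stay_le1 a D i.+1 m (x - a i); lra.
- have := stay_le1 a D' i.+1 m (x + a i).
  have := stay_le1 a D' i.+1 m (x - a i); lra.
Qed.

Lemma survival_nonpos (R : realType) (a : nat -> R) (delta : R) :
  0 < delta -> (forall k, delta <= a k) ->
  forall i x, survival a (fun y => y <= 0) i x = 0.
Proof.
move=> d0 ha; apply: (@survival_zero_one _ _ _ 2^-1); first by lra.
move=> i x.
pose D := (fun y : R => y <= 0); pose D' := fun y => D (x + x - y).
(* [D'] mirrors [D] around the start [x], so [predI D D'] is [2 x <= y <= 0]. *)
have strip0 : survival a (predI D D') i x = 0.
  apply: (@survival_bounded _ _ _ delta (x + x) 0) => // y /andP[].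
  by rewrite /D' /D; lra.
have refl m : stay a D' i m x = stay a D i m x by rewrite stay_reflect addrK.
have le m : 2 * stay a D i m x <= 1 + stay a (predI D D') i m x.
  by have := stay_add_le a D D' m i x; rewrite refl; lra.
suff : 2 * survival a D i x <= 1 + survival a (predI D D') i x.
  by rewrite strip0; lra.
apply: (@ler_cvg_to _ \oo _ _ (fun m => 2 * stay a D i m x)
                      (fun m => 1 + stay a (predI D D') i m x)).
- by apply: cvgMl_tmp; apply: stay_cvg.
- by apply: cvgD; [exact: cvg_cst|exact: stay_cvg].
- exact: nearW.
Qed.

Lemma survival_nonneg (R : realType) (a : nat -> R) (delta : R) :
  0 < delta -> (forall k, delta <= a k) ->
  forall i x, survival a (fun y => 0 <= y) i x = 0.
Proof.
move=> d0 ha i x.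
apply: etrans (survival_nonpos d0 ha i (0 - x)); rewrite /survival.
congr (limn _); apply/funext => m; rewrite -stay_reflect.
by congr (stay _ _ _ _ _); apply/funext => y; rewrite sub0r oppr_le0.
Qed.

(** * From the recursion to the probability space *)

(** Position of the walk after the signs coded by [e]: [false] is an up-step and
[true] a down-step. *)
Definition word_sum (R : realType) (a : nat -> R) (e : seq bool) : R :=
  \sum_(k < size e) a k * (-1) ^+ nth false e k.

Definition cylinder (d : measure_display) (T : measurableType d)
    (R : realType) (P : probability T R) (X : nat -> {RV P >-> R})
    (e : seq bool) : set T :=
  [set w | forall k, (k < size e)%N -> X k w = (-1) ^+ nth false e k].

Lemma measurable_preimage1 (d : measure_display) (T : measurableType d)
    (R : realType) (P : probability T R) (Y : {RV P >-> R}) (y : R) :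
  measurable (Y @^-1` [set y]).
Proof. by rewrite -[X in measurable X]setTI; apply: measurable_funP. Qed.

Lemma cylinderE (d : measure_display) (T : measurableType d)
    (R : realType) (P : probability T R) (X : nat -> {RV P >-> R}) e :
  cylinder X e = \bigcap_(k in [set` [fset k in iota 0 (size e)]%fset])
                   (X k @^-1` [set (-1) ^+ nth false e k]).
Proof.
apply/seteqP; split => w /= h k.
  by rewrite /= inE /= mem_iota add0n => /h.
by move=> ke; apply: h; rewrite /= inE /= mem_iota add0n.
Qed.

Lemma measurable_cylinder (d : measure_display) (T : measurableType d)
    (R : realType) (P : probability T R) (X : nat -> {RV P >-> R}) e :
  measurable (cylinder X e).
Proof.
rewrite cylinderE; apply: fin_bigcap_measurable.
  exact: finite_fset.
by move=> k _; apply: measurable_preimage1.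
Qed.

Lemma prob_cylinder (d : measure_display) (T : measurableType d)
    (R : realType) (P : probability T R) (X : nat -> {RV P >-> R}) e :
  iid_rademacher X -> P (cylinder X e) = (2^-1 ^+ size e)%:E.
Proof.
move=> [indX radX]; rewrite cylinderE indX; last by move=> *; exact: measurable_set1.
rewrite (eq_bigr (fun=> (2^-1)%:E)); last first.
  move=> k _; have [r1 r2] := radX k.
  by case: (nth _ _ _); rewrite ?expr1 ?expr0.
rewrite prodEFin; congr (_%:E).
by rewrite big_const_seq count_predT iter_mulr_1 card_fseq undup_id ?iota_uniq // size_iota.
Qed.

Lemma word_sum_rcons (R : realType) (a : nat -> R) e (b : bool) :
  word_sum a (rcons e b) = word_sum a e + a (size e) * (-1) ^+ b.
Proof.
rewrite /word_sum size_rcons big_ord_recr /= nth_rcons ltnn eqxx; congr (_ + _).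
by apply: eq_bigr => k _; rewrite nth_rcons ltn_ord.
Qed.

Lemma cylinder_sum (d : measure_display) (T : measurableType d)
    (R : realType) (P : probability T R) (X : nat -> {RV P >-> R}) a e w :
  cylinder X e w -> weighted_sum a X (size e) w = word_sum a e.
Proof. by move=> h; apply: eq_bigr => k _; rewrite h. Qed.

Lemma cylinder_rcons (d : measure_display) (T : measurableType d)
    (R : realType) (P : probability T R) (X : nat -> {RV P >-> R}) e (b : bool) w :
  cylinder X e w -> X (size e) w = (-1) ^+ b -> cylinder X (rcons e b) w.
Proof.
move=> h hb k; rewrite size_rcons ltnS leq_eqVlt nth_rcons => /orP[/eqP ->|ke].
  by rewrite ltnn eqxx.
by rewrite ke h.
Qed.

(** Induction on [m], splitting the cylinder of [e] along the next sign, mirrors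
the recursion defining [stay].  The event is
covered by a measurable set rather than measured itself, because such covers
can be assembled directly from cylinders. *)
Lemma stay_cover (d : measure_display) (T : measurableType d) (R : realType)
    (P : probability T R) (X : nat -> {RV P >-> R}) (a : nat -> R)
    (D : pred R) m e :
  iid_rademacher X ->
  exists F : set T, [/\ measurable F,
    (P F <= (2^-1 ^+ size e * stay a D (size e) m (word_sum a e))%:E)%E &
    forall w, (forall k, exists b : bool, X k w = (-1) ^+ b) ->
      cylinder X e w ->
      (forall n, (size e <= n)%N -> D (weighted_sum a X n w)) -> F w].
Proof.
move=> hX; elim: m e => [|m IH] e;
  (have [De|nDe] := boolP (D (word_sum a e)); last first).
- exists set0; split; first exact: measurable0.
    by rewrite measure0 stay_out // mulr0.
  by move=> w _ we /(_ _ (leqnn _)); rewrite (cylinder_sum _ we) (negbTE nDe).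
- exists (cylinder X e); split => //; first exact: measurable_cylinder.
  by rewrite prob_cylinder //= De mulr1.
- exists set0; split; first exact: measurable0.
    by rewrite measure0 stay_out // mulr0.
  by move=> w _ we /(_ _ (leqnn _)); rewrite (cylinder_sum _ we) (negbTE nDe).
- have [F0 [mF0 PF0 cF0]] := IH (rcons e false).
  have [F1 [mF1 PF1 cF1]] := IH (rcons e true).
  exists (F0 `|` F1); split; first exact: measurableU.
    have := @measureU2 _ _ _ P _ _ mF0 mF1; move=> /le_trans; apply.
    apply: le_trans (leeD PF0 PF1) _.
    rewrite -EFinD lee_fin !word_sum_rcons !size_rcons stayS //.
    rewrite expr0 expr1 mulr1 mulrN1 exprS; lra.
  move=> w sgnw we Dw; have [b hb] := sgnw (size e).
  have web := cylinder_rcons we hb.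
  have Dw' n : (size (rcons e b) <= n)%N -> D (weighted_sum a X n w).
    by rewrite size_rcons => /ltnW/Dw.
  case: b {hb} web Dw' => web Dw'; [right; exact: cF1|left; exact: cF0].
Qed.

(** The covers given by [stay_cover] for all horizons [m] intersect in a set whose
probability is at most the limit of [stay], which vanishes. *)
Lemma cylinder_confined_negligible (d : measure_display) (T : measurableType d)
    (R : realType) (P : probability T R) (X : nat -> {RV P >-> R})
    (a : nat -> R) (D : pred R) e :
  iid_rademacher X -> survival a D (size e) (word_sum a e) = 0 ->
  P.-negligible [set w | [/\ forall k, exists b : bool, X k w = (-1) ^+ b,
    cylinder X e w &
    forall n, (size e <= n)%N -> D (weighted_sum a X n w)]].
Proof.
move=> hX v0.
have /choice[F hF] := fun m => @stay_cover _ _ _ _ X a D m e hX.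
have mF m : measurable (F m) by have [] := hF m.
have mI : measurable (\bigcap_m F m) by apply: bigcap_measurable.
exists (\bigcap_m F m); split => //; last first.
  by move=> w [sw we Dw] m _; have [_ _ cov] := hF m; apply: cov.
apply/eqP; rewrite eq_le measure_ge0 andbT.
have le m : (P (\bigcap_m F m) <= (stay a D (size e) m (word_sum a e))%:E)%E.
  have [_ PF _] := hF m.
  have sub : \bigcap_m F m `<=` F m by apply: bigcap_inf.
  apply: (le_trans (le_measure P _ _ sub)); rewrite ?inE //.
  apply: le_trans PF _; rewrite lee_fin ler_piMl ?stay_ge0 //.
  by rewrite exprn_ile1 //; lra.
rewrite -(fineK (fin_num_measure P _ mI)) lee_fin -v0.
apply: limr_ge; first exact: stay_cvg.
by apply: nearW => m; rewrite -lee_fin fineK ?fin_num_measure.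
Qed.

Lemma rademacher_sign_ae (d : measure_display) (T : measurableType d)
    (R : realType) (P : probability T R) (Y : {RV P >-> R}) :
  rademacher Y -> P.-negligible [set w | ~ exists b : bool, Y w = (-1) ^+ b].
Proof.
move=> [h1 h2].
pose A := Y @^-1` [set 1] `|` Y @^-1` [set -1].
have mA : measurable A by apply: measurableU; apply: measurable_preimage1.
have PA : P A = 1%E.
  apply: etrans (measureU P _ _ _) _.
  - exact: measurable_preimage1.
  - exact: measurable_preimage1.
  - apply/seteqP; split => // w [/= -> ] /eqP; rewrite -subr_eq0 opprK.
    by rewrite (_ : 1 + 1 = 2%:R) // pnatr_eq0.
  - by apply: etrans (congr2 _ h1 h2) _; rewrite -EFinD; congr (_%:E); lra.
exists (~` A); split; first exact: measurableC.
  by rewrite probability_setC // PA subee.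
move=> w /= nb [] /= h; apply: nb; [exists false|exists true];
  by rewrite h ?expr0 ?expr1.
Qed.

(** A path which leaves [D] finitely often is confined to [D] after some finite
sign word, or has a step which is not a sign. *)
Lemma escape_infinitely_often (d : measure_display) (T : measurableType d)
    (R : realType) (P : probability T R) (X : nat -> {RV P >-> R})
    (a : nat -> R) (D : pred R) :
  iid_rademacher X -> (forall i x, survival a D i x = 0) ->
  \forall w \ae P, infinite_set [set n | ~~ D (weighted_sum a X n w)].
Proof.
move=> hX v0.
pose confined e := [set w | [/\ forall k, exists b : bool, X k w = (-1) ^+ b,
    cylinder X e w &
    forall n, (size e <= n)%N -> D (weighted_sum a X n w)]].
pose N1 := \bigcup_k [set w | ~ exists b : bool, X k w = (-1) ^+ b].
(* A number coding no word is read as the empty word, so [N2] is the union of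
   [confined e] over all words [e]. *)
pose N2 := \bigcup_k confined (odflt [::] (choice.unpickle k)).
have n1 : P.-negligible N1.
  by apply: negligible_bigcup => k; exact: rademacher_sign_ae (hX.2 k).
have n2 : P.-negligible N2.
  apply: negligible_bigcup => k.
  exact: cylinder_confined_negligible hX (v0 _ _).
apply: negligibleS (negligibleU n1 n2) => w /= fin.
have [sw|nsw] := pselect (forall k, exists b : bool, X k w = (-1) ^+ b); last first.
  by left; move/existsNP: nsw => [k hk]; exists k.
right.
have /choice[b hb] := sw.
move: fin => /contrapT fin.
have [M hM] : exists M, forall n, (M <= n)%N -> D (weighted_sum a X n w).
  have /finite_seqP[s hs] := fin.
  exists (\max_(i <- s) i).+1 => n Mn.
  apply/negPn/negP => nD.
  have : n \in s by have : [set` s] n by rewrite -hs.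
  by move=> ns; move: Mn; rewrite ltnNge (@leq_bigmax_seq _ s predT id n).
exists (choice.pickle (mkseq b M)) => //; rewrite choice.pickleK; split => //.
  by move=> k; rewrite size_mkseq => kM; rewrite hb nth_mkseq.
by rewrite size_mkseq.
Qed.

Theorem theorem2 (d : measure_display) (T : measurableType d) (R : realType)
    (P : probability T R) (X : nat -> {RV P >-> R}) (a : nat -> R)
    (hX : iid_rademacher X)
    (a_gt0 : forall i, 0 < a i)
    (a_nondecreasing : nondecreasing_seq a) :
  (\forall w \ae P, infinite_set [set n | 0 < weighted_sum a X n w]) /\
  (\forall w \ae P, infinite_set [set n | weighted_sum a X n w < 0]).
Proof.
have ha k : a 0%N <= a k by apply: a_nondecreasing.
have a0 := a_gt0 0%N.
split.
- have := escape_infinitely_often hX (survival_nonpos a0 ha).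
  apply: filterS => w.
  by under eq_set do rewrite -ltNge.
- have := escape_infinitely_often hX (survival_nonneg a0 ha).
  apply: filterS => w.
  by under eq_set do rewrite -ltNge.
Qed.
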